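(* Let $p\ge 1$ and suppose that $\varphi$ satisfies $$\lim_{s\downarrow 0}\frac{\varphi(1-sx)}{\varphi(1-s)}=x^p\qquad\text{for all } x>0 .$$ Let $j\in\{1,\dots,d\}$ and $u\in(u_{0j},1)$, and suppose that the second derivative of $\varphi$ exists in a neighborhood of $u$, and that it is continuous at $u$ with $\varphi''(u)\neq 0\neq\varphi'(u)$. Then for every $\boldsymbol{x}=(x_1,\dots,x_{d-1})\in\mathbb{R}^{d-1}$ with $x_i\le 0$ for all $i$, $$\lim_{n\to\infty}\Big(H_{j,u}\big(\boldsymbol{1}+c\,a_n\boldsymbol{x}\big)\Big)^n=\exp\Big(-\sum_{i=1}^{d-1}(-x_i)^p\Big),$$ where $c:=\big(\varphi'(u)^2/\varphi''(u)\big)^{1/p}$ and $a_n:=1-\varphi^{-1}(1/n)$ for $n\ge n_0$ ($n_0$ being large enough that $1/n$ lies in the range of $\varphi$ for $n\ge n_0$).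
   Context: Setting: $d\ge 2$; $\varphi:(0,1]\to[0,\infty)$ is convex and strictly decreasing with $\varphi(1)=0$ (the generator). $\boldsymbol{U}=(U_1,\dots,U_d)$ is a random vector whose distribution function $F$ coincides in its upper tail with an Archimedean distribution function: there is $\boldsymbol{u}_0=(u_{01},\dots,u_{0d})\in(0,1)^d$ such that for all $\boldsymbol{u}=(u_1,\dots,u_d)\in\prod_{i=1}^d[u_{0i},1]$, $$F(\boldsymbol{u})=C_\varphi(\boldsymbol{u}):=\varphi^{-1}\big(\varphi(u_1)+\dots+\varphi(u_d)\big),$$ with the convention $\varphi^{-1}(t):=0$ for $t\ge\lim_{s\downarrow0}\varphi(s)$ when this limit is finite. $H_{j,u}$ denotes the conditional distribution function of $(U_i)_{i\ne j}$ (a function of $d-1$ variables $u_i$, $i\neq j$) given $U_j=u$: $$H_{j,u}\big((u_i)_{i\neq j}\big):=P(U_i\le u_i,\ i\ne j\mid U_j=u):=\lim_{\varepsilon\downarrow 0}\frac{P(U_i\le u_i,\ i\neq j,\ U_j\in(u,u+\varepsilon])}{P(U_j\in(u,u+\varepsilon])},$$ considered for $u_i\in[u_{0i},1]$, $i\ne j$. Vector operations are componentwise and $\boldsymbol{1}=(1,\dots,1)\in\mathbb{R}^{d-1}$; for fixed $\boldsymbol{x}$, the point $\boldsymbol{1}+ca_n\boldsymbol{x}$ lies in this upper region for all large $n$. *)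

(* Defs.v *)
From HB Require Import structures.
From mathcomp Require Export all_boot all_order all_algebra.
From mathcomp Require Export all_classical all_reals all_analysis.
Export Order.TTheory GRing.Theory Num.Theory.
Export numFieldNormedType.Exports.

Set Implicit Arguments.
Unset Strict Implicit.
Unset Printing Implicit Defensive.

Local Open Scope classical_set_scope.
Local Open Scope ring_scope.

(* [phi] is a total function of which only the values on (0, 1] matter. *)
Definition archimedean_generator (R : realType) (phi : R -> R) : Prop :=
  [/\ forall s, 0 < s <= 1 -> 0 <= phi s,
      convex_function (`]0, 1] : set R) phi,
      {in `]0, 1] &, {homo phi : s t / s < t >-> t < s}} &
      phi 1 = 0].

(* A generator is a bijection from (0, 1] onto [0, phi(0+)); for
   t >= phi(0+) there is no preimage and the value is 0. *)
Definition generator_inv (R : realType) (phi : R -> R) (t : R) : R :=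
  xget 0 [set s | 0 < s <= 1 /\ phi s = t].

Definition archimedean_cdf (R : realType) (d : nat) (phi : R -> R)
    (v : 'rV[R]_d) : R :=
  generator_inv phi (\sum_(i < d) phi (v 0 i)).

Section joint_distribution.
Context {dT : measure_display} {T : measurableType dT} {R : realType}.
Context (P : probability T R) {d : nat}.
Implicit Type U : 'I_d -> {RV P >-> R}.

Definition joint_cdf U (v : 'rV[R]_d) : R :=
  fine (P [set w | forall i, U i w <= v 0 i]).

(* The coordinates other than [j] are enumerated by [lift j].
   [lim] is 0 when the difference quotient does not converge. *)
Definition cond_cdf U (j : 'I_d) (u : R) (v : 'rV[R]_d.-1) : R :=
  lim (fine (P [set w | (forall i, U (lift j i) w <= v 0 i) /\
                        u < U j w <= u + e])
       / fine (P [set w | u < U j w <= u + e]) @[e --> 0^'+]).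

End joint_distribution.

(* Main.v *)
Require Import Defs.
From mathcomp Require Import ring lra.

(** Write [g] for the inverse generator and [S] for the sum of [phi (v i)] over
the coordinates [i] other than [j].  In the upper region the joint distribution
function at [v] completed by [t] in position [j] is [g (S + phi t)], so the
conditional distribution function given that the [j]-th variable is [u] is the
derivative of [t |-> g (S + phi t)] at [u], divided by that of
[t |-> g (phi t) = t], which is [1] ([cond_ratioE], [cond_ratio_cvg]).  By the
inverse function rule it equals [H S = phi' u / phi' (g (phi u + S))]: all
conditioning points [v] enter through the single number [S].

The function [H] is [1] at [0] and its derivative there is
[- phi'' u / (phi' u)^2] ([cond_ratio_is_derive]); it has to be raised to the
power [n] along [S_n], the value of [S] at [1 + c a_n x].  Since
[phi (1 - a_n) = 1 / n], the product [n S_n] is a sum of the quotients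
[phi (1 - a_n (- c x_i)) / phi (1 - a_n)], which by regular variation tend to
[c^p (- x_i)^p] ([generator_scaled_cvg]).  As in the limit of [(1 + y / n)^n],
[H (S_n)^n] tends to [exp (H' 0 * lim n S_n)] ([expn_cvg_expR]), and [c] is
chosen so that [c^p] cancels [phi'' u / (phi' u)^2].

Convexity of [phi] is used twice.  It makes [phi] continuous up to [1], so that
[1 / n] is attained near [1] and [a_n] tends to [0].  It also makes [phi'' u]
nonnegative ([second_derivative_ge0]), hence positive, and so is the base of the
real power defining [c]. *)

Set Implicit Arguments.
Unset Strict Implicit.
Unset Printing Implicit Defensive.

Local Open Scope classical_set_scope.
Local Open Scope ring_scope.

(** * Limits of sequences *)

Lemma cvg_at_rightI {R : realType} (f : nat -> R) (a : R) :
  f n @[n --> \oo] --> a -> (\forall n \near \oo, a < f n) ->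
  f n @[n --> \oo] --> a^'+.
Proof.
move=> fa af A /fa fA; apply: filterS2 af fA => n an; exact.
Qed.

Lemma invn_lt {R : realType} (t : R) : 0 < t ->
  \forall n \near \oo, 0 < (n%:R^-1 : R) < t.
Proof.
move=> t0; have n0 : (n%:R^-1 : R) @[n --> \oo] --> 0.
  by apply/gtr0_cvgV0; [near do rewrite ltr0n | exact: cvgr_idn].
near=> n; rewrite invr_gt0 ltr0n; apply/andP; split.
  by near: n; exact: nbhs_infty_gt.
by near: n; exact: (cvgr_lt _ n0).
Unshelve. all: by end_near. Qed.

Lemma cvg0_scaled {R : realType} (s : nat -> R) (L : R) :
  n%:R * s n @[n --> \oo] --> L -> s n @[n --> \oo] --> 0.
Proof.
move=> sL; have n0 : (n%:R^-1 : R) @[n --> \oo] --> 0.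
  by apply/gtr0_cvgV0; [near do rewrite ltr0n | exact: cvgr_idn].
rewrite -(mul0r L); apply: cvg_trans (cvgM n0 sL).
apply: near_eq_cvg; near=> n; rewrite /= mulKf// pnatr_eq0.
by rewrite -lt0n; near: n; exact: nbhs_infty_gt.
Unshelve. all: by end_near. Qed.

(** With [s n = y / n] and [f t = 1 + t] this is the limit of [(1 + y / n)^n].
The logarithm of [f] factors as [q t * t] with [q] continuous at [0] and
[q 0 = D], so that the logarithm of [f (s n) ^+ n] is [q (s n) * (n s n)]; this
factorization avoids dividing by [s n], which may vanish. *)
Lemma expn_cvg_expR {R : realType} (f : R -> R) (D L : R) (s : nat -> R) :
  f 0 = 1 -> is_derive (0 : R) 1 f D -> n%:R * s n @[n --> \oo] --> L ->
  f (s n) ^+ n @[n --> \oo] --> expR (D * L).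
Proof.
move=> f0 fD sL.
have s0 := cvg0_scaled sL.
have lD : is_derive (0 : R) 1 (@ln R \o f) D.
  have f0' : 0 < f 0 by rewrite f0.
  have := is_derive1_comp (is_derive1_ln f0') fD.
  by rewrite f0 invr1 mul1r.
have [q [qE qC q0]] := (is_derive1_caratheodory _ _ _).1 lD.
have fpos : \forall n \near \oo, 0 < f (s n).
  have fC : {for 0, continuous f}.
    by apply/differentiable_continuous/derivable1_diffP; case: fD.
  have fs : f (s n) @[n --> \oo] --> f 0.
    by apply: continuous_cvg.
  by apply: (cvgr_gt _ fs); rewrite f0.
have : expR (q (s n) * (n%:R * s n)) @[n --> \oo] --> expR (D * L).
  apply: continuous_cvg; first exact: continuous_expR.
  apply: cvgM => //; rewrite -q0.
  by apply: continuous_cvg.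
apply: cvg_trans; apply: near_eq_cvg; near=> n.
have fn : 0 < f (s n) by near: n.
have := qE (s n); rewrite /= f0 ln1 !subr0 => E.
by rewrite mulrCA -E expRM_natl lnK// posrE.
Unshelve. all: by end_near. Qed.

(** * Generators and their inverses *)

Section generator.
Context {R : realType} {phi : R -> R} (hphi : archimedean_generator phi).

Lemma generator_le s t : 0 < s -> s <= t -> t <= 1 -> phi t <= phi s.
Proof.
case: hphi => _ _ decr _ s0; rewrite le_eqVlt => /orP[/eqP->//|st] t1.
by apply/ltW/decr => //; rewrite in_itv/= ?s0 ?t1 ?(lt_trans s0 st)//
  (ltW (lt_le_trans st t1)).
Qed.

Lemma generator_ge0 s : 0 < s -> s <= 1 -> 0 <= phi s.
Proof. by case: hphi => nn _ _ _ s0 s1; rewrite nn ?s0. Qed.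

Lemma generator1 : phi 1 = 0.
Proof. by case: hphi. Qed.

Lemma generator_gt0 s : 0 < s < 1 -> 0 < phi s.
Proof.
case: hphi => _ _ decr h1 /andP[s0 s1].
by rewrite -h1; apply: decr; rewrite ?in_itv/= ?s0 ?(ltW s1) ?ltr01 ?lexx.
Qed.

Lemma generatorK s : 0 < s <= 1 -> generator_inv phi (phi s) = s.
Proof.
case: hphi => _ _ decr _ s01; apply: xget_unique => // y [y01 yE].
case: (ltgtP y s) => // ys.
- by have := decr y s; rewrite !in_itv/= => /(_ y01 s01 ys); rewrite yE ltxx.
- by have := decr s y; rewrite !in_itv/= => /(_ s01 y01 ys); rewrite yE ltxx.
Qed.

(** Convexity with the weights cleared of denominators, [b] lying between [a]
and [c]: the form in which slopes of chords are compared below. *)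
Lemma generator_three_point a b c : 0 < a -> a < b -> b < c -> c <= 1 ->
  (c - a) * phi b <= (c - b) * phi a + (b - a) * phi c.
Proof.
move=> a0 ab bc c1.
have ca : 0 < c - a by rewrite subr_gt0 (lt_trans ab).
have t0 : 0 <= (c - b) / (c - a) by apply: divr_ge0; lra.
have t1 : (c - b) / (c - a) <= 1.
  by rewrite ler_pdivrMr// mul1r lerD2l lerN2 ltW.
have := hphi => -[_ /(_ (Itv01 t0 t1) a c) conv _ _].
have aD : a \in (`]0, 1] : set R)%classic.
  by rewrite inE/= in_itv/=; lra.
have cD : c \in (`]0, 1] : set R)%classic.
  by rewrite inE/= in_itv/=; lra.
move: conv => /(_ aD cD); rewrite !convRE/= /mathcomp.classical.unstable.onem.
have -> : conv (Itv01 t0 t1) (a : convex_lmodType R^o)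
    (c : convex_lmodType R^o) = b.
  rewrite [LHS]/conv/= /mathcomp.classical.unstable.onem /GRing.scale/=.
  by field; rewrite gt_eqF.
have -> : (c - b) / (c - a) * phi a + (1 - (c - b) / (c - a)) * phi c
   = ((c - b) * phi a + (b - a) * phi c) / (c - a) by field; rewrite gt_eqF.
by rewrite ler_pdivlMr// mulrC.
Qed.

(** By convexity the chord from [s] to [t] is no steeper than the chord from
[1/4] to [t], which has width at least [1/4] and height at most
[phi (1/4)].  The point [1/2] stands for any point of [(0, 1)]: only a left
neighbourhood of [1] matters for the scaling sequence. *)
Lemma generator_lipschitz s t : 2^-1 <= s -> s <= t -> t <= 1 ->
  phi s - phi t <= 4 * phi 4^-1 * (t - s).
Proof.
move=> s2; rewrite le_eqVlt => /orP[/eqP->|st] t1.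
  by rewrite !subrr mulr0.
have q0 : (0 : R) < 4^-1 by lra.
have qs : (4^-1 : R) < s by lra.
have s0 : 0 < s by lra.
have := generator_three_point q0 qs st t1.
have := generator_le s0 (ltW st) t1.
have : 0 <= phi 4^-1 by apply: generator_ge0; lra.
have : 0 <= phi t by apply: generator_ge0; lra.
nra.
Qed.

Lemma generator_continuous : {within `[2^-1, 1], continuous phi}.
Proof.
apply/subspace_continuousP => s sD; apply/cvgrPdist_le => e e0.
have := sD; rewrite /= in_itv/= => /andP[s2 s1].
have K0 : 0 < 4 * phi 4^-1 by rewrite mulr_gt0// generator_gt0//; lra.
rewrite near_withinE; near=> t; rewrite /= in_itv/= => /andP[t2 t1].
have : `|s - t| <= e / (4 * phi 4^-1).
  by near: t; apply: cvgr_dist_le; [exact: cvg_id | rewrite divr_gt0].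
rewrite ler_pdivlMr//.
rewrite /from_subspace; case: (lerP s t) => st.
- have h := generator_le (lt_le_trans (ltac:(lra) : 0 < 2^-1) s2) st t1.
  rewrite ger0_norm ?subr_ge0//.
  by have := generator_lipschitz s2 st t1; lra.
- have h := generator_le (lt_le_trans (ltac:(lra) : 0 < 2^-1) t2) (ltW st) s1.
  rewrite ler0_norm ?subr_le0//.
  by have := generator_lipschitz t2 (ltW st) s1; lra.
Unshelve. all: by end_near. Qed.

Lemma generator_invK t : 0 <= t <= phi 2^-1 ->
  2^-1 <= generator_inv phi t <= 1 /\ phi (generator_inv phi t) = t.
Proof.
move=> t01; have h2 : (2^-1 : R) <= 1 by lra.
have := IVT (v := t) h2 generator_continuous.
rewrite generator1 min_r ?max_l ?generator_ge0//; [|lra..].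
move=> /(_ t01)[s]; rewrite in_itv/= => /andP[s2 s1] <-.
by rewrite generatorK ?s2 ?s1 ?andbT//; lra.
Qed.

Lemma generator_inv_small : \forall n \near \oo, 0 < (n%:R^-1 : R) <= phi 2^-1.
Proof.
have p0 : 0 < phi 2^-1 by apply: generator_gt0; lra.
by apply: filterS (invn_lt p0) => n /andP[-> /ltW].
Qed.

(** The scaling sequence [a_n] tends to [0] because [1 / n] eventually drops
below [phi (1 - e)], and it is positive because [phi] does not take the value
[1 / n] at [1]; approaching from the right is what regular variation needs. *)
Lemma generator_inv_cvg1 :
  1 - generator_inv phi n%:R^-1 @[n --> \oo] --> 0^'+.
Proof.
have gen_inv : \forall n \near \oo, [/\ generator_inv phi n%:R^-1 <= 1,
    phi (generator_inv phi n%:R^-1) = n%:R^-1,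
    2^-1 <= generator_inv phi n%:R^-1 & 0 < (n%:R^-1 : R)].
  apply: filterS generator_inv_small => n /andP[n1 n2].
  by have [|/andP[-> ->] ->] := @generator_invK n%:R^-1; rewrite ?(ltW n1).
apply: cvg_at_rightI; last first.
  apply: filterS gen_inv => n [h E _ npos].
  rewrite subr_gt0 lt_neqAle h andbT; apply/eqP => h1.
  by move: npos; rewrite -E h1 generator1 ltxx.
apply/cvgrPdist_lt => e e0.
(* The minimum with 1/2 keeps [1 - e] inside the domain of [phi]. *)
have m0 : 0 < Num.min e 2^-1 by rewrite lt_min e0; lra.
have m1 : Num.min e 2^-1 <= 2^-1 by rewrite ge_min lexx orbT.
have me : Num.min e 2^-1 <= e by rewrite ge_min lexx.
have /invn_lt : 0 < phi (1 - Num.min e 2^-1) by apply: generator_gt0; lra.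
apply: filterS2 gen_inv => n [h2 E h1 npos] /andP[_]; rewrite -[X in X < _]E.
case: (leP (generator_inv phi n%:R^-1) (1 - Num.min e 2^-1)) => [le|ge].
  by rewrite ltNge generator_le//; lra.
by move=> _; rewrite sub0r normrN ger0_norm ?subr_ge0//; lra.
Qed.

End generator.

(** Because [n = 1 / phi (1 - a_n)], this is regular variation along [a_n].  The
case [x = 0], excluded there, holds because both sides vanish. *)
Lemma generator_scaled_cvg {R : realType} {phi : R -> R} (p c x : R) :
  archimedean_generator phi -> 0 < p -> 0 < c -> x <= 0 ->
  (forall x : R, 0 < x ->
    phi (1 - s * x) / phi (1 - s) @[s --> 0^'+] --> x `^ p) ->
  n%:R * phi (1 + c * (1 - generator_inv phi n%:R^-1) * x) @[n --> \oo]
    --> c `^ p * (- x) `^ p.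
Proof.
move=> hphi p0 c0; rewrite le_eqVlt => /orP[/eqP -> _|x0 hreg].
  rewrite oppr0 powR0 ?gt_eqF// mulr0.
  under eq_fun do rewrite mulr0 addr0 (generator1 hphi) mulr0.
  exact: cvg_cst.
have nx0 : 0 < - x by rewrite oppr_gt0.
rewrite -powRM ?ltW//.
pose a n := 1 - generator_inv phi n%:R^-1.
have : phi (1 - a n * (c * - x)) / phi (1 - a n) @[n --> \oo] -->
    (c * - x) `^ p.
  exact: cvg_comp (generator_inv_cvg1 hphi) (hreg _ (mulr_gt0 c0 nx0)).
apply: cvg_trans; apply: near_eq_cvg; near=> n.
have /andP[n0 n2] : 0 < (n%:R^-1 : R) <= phi 2^-1.
  by near: n; exact: generator_inv_small.
have n02 : 0 <= (n%:R^-1 : R) <= phi 2^-1 by rewrite (ltW n0).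
have [_] := generator_invK hphi n02.
rewrite /a subKr => ->; rewrite invrK mulrC; congr (_ * phi _); ring.
Unshelve. all: by end_near. Qed.

(** * Second derivative and local inversion *)

(** Were [phi''] negative at [u], it would be so on a neighbourhood by
continuity.  The mean value theorem turns the increasing slopes of the chords
over [u - h, u] and [u, u + h] into points [z1 < u < z2] with
[phi' z1 <= phi' z2], and applied once more to [phi'] it produces a point
between them where [phi''] is nonnegative. *)
Lemma second_derivative_ge0 {R : realType} (phi : R -> R) (u : R) :
  archimedean_generator phi -> 0 < u < 1 ->
  (\forall v \near u, derivable phi v 1 /\ derivable (derive1 phi) v 1) ->
  {for u, continuous (derive1n 2 phi)} -> 0 <= derive1n 2 phi u.
Proof.
move=> hphi /andP[u0 u1] hder hcont; rewrite leNgt; apply/negP => neg.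
have hneg : \forall v \near u, derive1n 2 phi v < 0.
  exact: cvgr_lt hcont _ neg.
have : \forall v \near u, [/\ 0 < v, v < 1, derive1n 2 phi v < 0,
    derivable phi v 1 & derivable (derive1 phi) v 1].
  near=> v.
  have [d1 d2] : derivable phi v 1 /\ derivable (derive1 phi) v 1 by near: v.
  split; [| | |exact: d1|exact: d2].
  - by near: v; exact: lt_nbhsr.
  - by near: v; exact: lt_nbhsl.
  - by near: v.
case=> e /= e0 He.
have H v : `|v - u| < e -> [/\ 0 < v, v < 1, derive1n 2 phi v < 0,
    derivable phi v 1 & derivable (derive1 phi) v 1].
  by move=> ve; apply: He; rewrite /= distrC.
clear He.
pose h := e / 2; have h0 : 0 < h by rewrite divr_gt0.
have he : h < e by rewrite /h; lra.
have inB z : u - h <= z <= u + h -> `|z - u| < e.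
  by move=> zI; rewrite ltr_distlC; lra.
have uhB : u - h <= u - h <= u + h by lra.
have uHB : u - h <= u + h <= u + h by lra.
have uh1 : u - h < u by lra.
have uh2 : u < u + h by lra.
have cl (f : R -> R) (x y : R) : (forall z, z \in `[x, y] -> derivable f z 1) ->
    {within `[x, y], continuous f}.
  move=> df; apply: derivable_within_continuous => z /df; exact.
have inE (x y z : R) :
    u - h <= x -> y <= u + h -> z \in `[x, y] -> `|z - u| < e.
  move=> h1 h2; rewrite in_itv/= => /andP[h3 h4]; apply: inB.
  by rewrite (le_trans h1 h3) (le_trans h4 h2).
have inO (x y z : R) : z \in `]x, y[ -> z \in `[x, y].
  by rewrite !in_itv/= => /andP[/ltW-> /ltW->].
have mvt (f : R -> R) (x y : R) :
    (forall z, `|z - u| < e -> derivable f z 1) ->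
    u - h <= x -> x < y -> y <= u + h ->
    exists2 z, x < z < y & f y - f x = derive1 f z * (y - x).
  move=> df ux xy yu.
  have dfz z : z \in `[x, y] -> derivable f z 1.
    by move=> zI; apply/df/(inE x y).
  have [z|z] := MVT (f := f) (df := derive1 f) xy _ (cl _ _ _ dfz).
    move=> zI; rewrite derive1E; apply: derivableP; exact/dfz/inO.
  by rewrite in_itv/= => zxy E; exists z.
have d1 z : `|z - u| < e -> derivable phi z 1 by move=> /H[].
have d2 z : `|z - u| < e -> derivable (derive1 phi) z 1 by move=> /H[].
have [z1 z1I E1] := mvt phi (u - h) u d1 ltac:(lra) ltac:(lra) ltac:(lra).
have [z2 z2I E2] := mvt phi u (u + h) d1 ltac:(lra) ltac:(lra) ltac:(lra).
have [z3 z3I E3] := mvt (derive1 phi) z1 z2 d2 ltac:(lra) ltac:(lra) ltac:(lra).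
have z3B : u - h <= z3 <= u + h by clear E1 E2 E3; lra.
have [_ _ n3 _ _] := H z3 (inB z3 z3B).
have [a0 _ _ _ _] := H (u - h) (inB _ uhB).
have [_ b1 _ _ _] := H (u + h) (inB _ uHB).
have C := generator_three_point hphi a0 uh1 uh2 (ltW b1).
move: n3; rewrite derive1nS => n3.
have : 0 <= derive1 phi z2 - derive1 phi z1.
  rewrite -(pmulr_rge0 _ h0).
  have -> : h * (derive1 phi z2 - derive1 phi z1)
      = (phi (u + h) - phi u) - (phi u - phi (u - h)) by rewrite E1 E2; ring.
  rewrite -(pmulr_rge0 _ h0); move: C; rewrite -subr_ge0; congr (0 <= _); ring.
have z12 : z1 < z2.
  by case/andP: z1I => _ z1u; case/andP: z2I => /(lt_trans z1u).
by rewrite leNgt E3 pmulr_llt0 ?n3// subr_gt0.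
Unshelve. all: by end_near. Qed.

Section inverse.
Context {R : realType} {phi : R -> R} (hphi : archimedean_generator phi).
Context {u : R} (u01 : 0 < u < 1)
  (hder : \forall v \near u, derivable phi v 1 /\ derivable (derive1 phi) v 1)
  (hphi1 : derive1 phi u != 0).

Lemma derivable1_continuous (f : R -> R) (v : R) :
  derivable f v 1 -> {for v, continuous f}.
Proof. by move=> /derivable1_diffP/differentiable_continuous. Qed.

(** The differentiability of [phi] on a neighbourhood of [u], and the continuity
of [phi'] at [u], which keeps [phi'] away from [0], are what make the inverse
function rule available at all points near [phi u] and not only at [phi u]. *)
Lemma generator_inv_is_derive : \forall S \near (0 : R),
  derive1 phi (generator_inv phi (phi u + S)) != 0 /\
  is_derive (phi u + S) 1 (generator_inv phi)
    (derive1 phi (generator_inv phi (phi u + S)))^-1.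
Proof.
have hcan : {near u, cancel phi (generator_inv phi)}.
  near=> v; apply: (generatorK hphi); apply/andP; split; last apply: ltW.
    by near: v; case/andP: u01 => u0 _; exact: lt_nbhsr.
  by near: v; case/andP: u01 => _ u1; exact: lt_nbhsl.
have hcont : {near u, continuous phi}.
  by apply: filterS hder => v [dv _]; exact: derivable1_continuous.
have hneq0 : \forall v \near u, derive1 phi v != 0.
  have cphi1 : {for u, continuous (derive1 phi)}.
    by apply: derivable1_continuous; case: (nbhs_singleton hder).
  exact: (cvgr_neq0 _ cphi1 hphi1).
have inv v : {near v, cancel phi (generator_inv phi)} ->
    {near v, continuous phi} ->
    derivable phi v 1 -> derive1 phi v != 0 ->
    is_derive (phi v) 1 (generator_inv phi) (derive1 phi v)^-1.
  move=> h1 h2 h3 h4; apply: is_derive_inverse => //.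
  by rewrite derive1E; exact: derivableP.
have hcan2 : \forall v \near u, {near v, cancel phi (generator_inv phi)}.
  exact: near_join hcan.
have hcont2 : \forall v \near u, {near v, continuous phi}.
  exact: near_join hcont.
have near_inv : \forall v \near u, derive1 phi v != 0 /\
    is_derive (phi v) 1 (generator_inv phi) (derive1 phi v)^-1.
  near=> v.
  have v0 : derive1 phi v != 0 by near: v.
  split=> //; apply: inv => //.
  - by near: v; exact: hcan2.
  - by near: v; exact: hcont2.
  - by near: v; apply: filterS hder => v [].
have [gcont gcan] := near_can_continuousAcan_sym hcan hcont.
have guE : generator_inv phi (phi u) = u by exact: nbhs_singleton hcan.
have ginv : \forall t \near phi u, derive1 phi (generator_inv phi t) != 0 /\
    is_derive t 1 (generator_inv phi) (derive1 phi (generator_inv phi t))^-1.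
  near=> t; have tE : phi (generator_inv phi t) = t by near: t.
  rewrite -{2}tE; near: t.
  have := nbhs_singleton gcont; rewrite /continuous_at guE => /(_ _ near_inv).
  exact.
have shift : phi u + S @[S --> (0 : R)] --> phi u.
  by rewrite -[X in _ --> X]addr0; apply: cvgD; [exact: cvg_cst|exact: cvg_id].
exact: (shift _ ginv).
Unshelve. all: by end_near. Qed.

(** The function below is the conditional distribution function as a function of
the sum [S] of generator values; its slope at [0] is the exponential rate. *)
Lemma cond_ratio_is_derive :
  is_derive (0 : R) 1
    (fun S => derive1 phi u / derive1 phi (generator_inv phi (phi u + S)))
    (- (derive1n 2 phi u / derive1 phi u ^+ 2)).
Proof.
have guE : generator_inv phi (phi u) = u.
  by apply: (generatorK hphi); case/andP: u01 => -> /ltW ->.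
have [_] := nbhs_singleton generator_inv_is_derive.
rewrite addr0 guE => dg.
have dS : is_derive (0 : R) 1 (fun S => phi u + S) 1.
  have := is_deriveD (is_derive_cst (phi u) (0 : R) 1) (is_derive_id (0 : R) 1).
  by rewrite add0r.
have dgS : is_derive (0 : R) 1 (fun S => generator_inv phi (phi u + S))
    (derive1 phi u)^-1.
  rewrite -[X in is_derive _ _ _ X]mulr1.
  apply: (@is_derive1_comp _ (generator_inv phi) (fun S => phi u + S)).
  by rewrite addr0.
have d2 : is_derive (generator_inv phi (phi u + 0)) 1 (derive1 phi)
    (derive1n 2 phi u).
  rewrite addr0 guE derive1nS /derive1n/= derive1E.
  by apply: derivableP; case: (nbhs_singleton hder).
have :=
  @is_derive1_comp _ _ (fun S => generator_inv phi (phi u + S)) _ _ _ d2 dgS.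
move=> /(is_deriveV _)/=; rewrite addr0 guE => /(_ hphi1) dV.
have := is_deriveZ (derive1 phi u) dV.
set z := _ *: (_ *: _). have -> : z = - (derive1n 2 phi u / derive1 phi u ^+ 2).
  by rewrite /z /GRing.scale/=; field.
by [].
Qed.

Lemma cond_ratio_cvg : \forall S \near (0 : R),
  (generator_inv phi (S + phi (u + e)) - generator_inv phi (S + phi u)) / e
     @[e --> 0^'+] -->
  derive1 phi u / derive1 phi (generator_inv phi (phi u + S)).
Proof.
apply: filterS generator_inv_is_derive => S [_].
rewrite (addrC (phi u) S) => dg.
have dphi : is_derive u 1 phi (derive1 phi u).
  by rewrite derive1E; apply: derivableP; case: (nbhs_singleton hder).
have dS : is_derive u 1 (fun v => S + phi v) (derive1 phi u).
  by have := is_deriveD (is_derive_cst S u 1) dphi; rewrite add0r.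
have := @is_derive1_comp _ (generator_inv phi) (fun v => S + phi v) u _ _ _ dS.
move=> /(_ _ dg) dh.
move: dh; rewrite mulrC => -[dh <-].
apply: cvg_trans (cvg_dnbhs_at_right dh).
apply: near_eq_cvg; near=> e.
by rewrite /= /shift/= [_ *: 1]mulr1 (addrC e u) mulrC.
Unshelve. all: by end_near. Qed.

End inverse.

(** * Conditional probabilities from the joint distribution function *)

Definition row_insert {R : realType} {d : nat} (j : 'I_d) (t : R)
    (v : 'rV[R]_d.-1) : 'rV[R]_d :=
  \row_i oapp (v 0) t (unlift j i).

Lemma row_insertP {R : realType} {d : nat} (j : 'I_d) (Q : 'I_d -> R -> Prop)
    (t : R) (v : 'rV[R]_d.-1) :
  (forall i, Q i (row_insert j t v 0 i)) <->
  (forall i, Q (lift j i) (v 0 i)) /\ Q j t.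
Proof.
split=> [H|[H1 H2] i].
  split=> [i|]; first by have := H (lift j i); rewrite mxE liftK.
  by have := H j; rewrite mxE unlift_none.
by rewrite mxE; case: unliftP => [k|] ->.
Qed.

Section joint.
Context {dT : measure_display} {T : measurableType dT} {R : realType}
  (P : probability T R) {d : nat} (U : 'I_d -> {RV P >-> R}).

Lemma measurable_orthant (I : finType) (X : I -> {RV P >-> R}) (v : I -> R) :
  measurable [set w | forall i, X i w <= v i].
Proof.
have -> : [set w | forall i, X i w <= v i] =
    \big[setI/setT]_(i : I) (X i @^-1` `]-oo, v i]).
  rewrite -bigcap_seq; apply/seteqP; split=> w /= H i.
    by move=> _; rewrite /= in_itv/=.
  by have := H i; rewrite /= mem_index_enum in_itv/=; exact.
apply: bigsetI_measurable => i _; rewrite -[X in measurable X]setTI.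
exact: measurable_funP.
Qed.

Lemma measurable_slab (X : {RV P >-> R}) (a b : R) :
  measurable [set w | a < X w <= b].
Proof.
have -> : [set w | a < X w <= b] = X @^-1` `]a, b].
  by apply/seteqP; split=> w /=; rewrite in_itv.
by rewrite -[X in measurable X]setTI; exact: measurable_funP.
Qed.

Lemma probability_slab (j : 'I_d) (v : 'rV[R]_d.-1) (a b : R) : a <= b ->
  fine (P [set w | (forall i, U (lift j i) w <= v 0 i) /\ a < U j w <= b]) =
  joint_cdf U (row_insert j b v) - joint_cdf U (row_insert j a v).
Proof.
move=> ab; rewrite /joint_cdf.
set A := [set w | forall i, U i w <= row_insert j a v 0 i].
set B := [set w | forall i, U i w <= row_insert j b v 0 i].
have mA : measurable A by exact: measurable_orthant.
have mB : measurable B by exact: measurable_orthant.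
have AE : A = [set w | (forall i, U (lift j i) w <= v 0 i) /\ U j w <= a].
  apply/seteqP; split=> w /=;
    by rewrite /A/= (row_insertP j (fun i => Order.le (U i w))).
have BE : B = [set w | (forall i, U (lift j i) w <= v 0 i) /\ U j w <= b].
  apply/seteqP; split=> w /=;
    by rewrite /B/= (row_insertP j (fun i => Order.le (U i w))).
have AB : A `<=` B.
  by rewrite AE BE => w /= [h1 h2]; split=> //; exact: le_trans h2 ab.
have -> : [set w | (forall i, U (lift j i) w <= v 0 i) /\ a < U j w <= b] =
    B `\` A.
  rewrite AE BE; apply/seteqP; split=> w /=.
    by move=> [h1 /andP[h2 h3]]; split=> // -[_]; rewrite leNgt h2.
  move=> [[h1 h2] h3]; split=> //.
  by rewrite h2 andbT ltNge; apply/negP => h; apply: h3.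
rewrite measureD// ?(le_lt_trans (probability_le1 _ mB)) ?ltry//.
by rewrite (setIidr AB) fineB// fin_num_measure.
Qed.

(** If some orthant has full measure, the constraints it puts on the coordinates
other than [j] hold almost surely.  This recovers the marginal law of the
[j]-th variable from the joint distribution function near the corner [1]. *)
Lemma probability_slab_marginal (j : 'I_d) (v : 'rV[R]_d.-1) (t a b : R) :
  joint_cdf U (row_insert j t v) = 1 ->
  fine (P [set w | a < U j w <= b]) =
  fine (P [set w | (forall i, U (lift j i) w <= v 0 i) /\ a < U j w <= b]).
Proof.
rewrite /joint_cdf.
set B := [set w | forall i, U i w <= row_insert j t v 0 i] => PB.
have mB : measurable B by exact: measurable_orthant.
set E := [set w | forall i, U (lift j i) w <= v 0 i].
have mE : measurable E by exact: (measurable_orthant (fun i => U (lift j i))).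
have mA : measurable [set w | a < U j w <= b] by exact: measurable_slab.
have PnB : P (~` B) = 0%E.
  by rewrite probability_setC// -[P B]fineK ?fin_num_measure// PB subee.
set A := [set w | a < U j w <= b] in mA *.
have PAE : P (A `\` E) = 0%E.
  apply: (subset_measure0 _ _ _ PnB); [exact: measurableD|exact: measurableC|].
  move=> w /= [_ wE] wB; apply: wE => i.
  by move: wB; rewrite /B/= (row_insertP j (fun i => Order.le (U i w))) => -[].
have -> : P A = P (A `&` E) by rewrite -[RHS]add0e -PAE; exact: measureDI.
congr (fine (P _)).
by apply/seteqP; split=> w /= [].
Qed.

Context {phi : R -> R} (hphi : archimedean_generator phi)
  {u0 : 'rV[R]_d} (hu0 : forall i, 0 < u0 0 i < 1)
  (hF : forall v : 'rV[R]_d, (forall i, u0 0 i <= v 0 i <= 1) ->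
    joint_cdf U v = archimedean_cdf phi v).

Lemma joint_cdf_row_insert (j : 'I_d) (v : 'rV[R]_d.-1) (t : R) :
  (forall i, u0 0 (lift j i) <= v 0 i <= 1) -> u0 0 j <= t <= 1 ->
  joint_cdf U (row_insert j t v) =
  generator_inv phi (\sum_(i < d.-1) phi (v 0 i) + phi t).
Proof.
move=> hv ht; rewrite hF; last first.
  by apply/(row_insertP j (fun i y => u0 0 i <= y <= 1)).
rewrite /archimedean_cdf (bigD1_ord j)//= mxE unlift_none/= addrC.
by congr (generator_inv _ (_ + _)); apply: eq_bigr => i _; rewrite mxE liftK.
Qed.

(** The denominator is [e], the generator being cancelled by its inverse: the
distribution function equals [1] at the corner [1], so the other variables are
almost surely at most [1] and the marginal is uniform in the upper region. *)
Lemma cond_ratioE (j : 'I_d) (v : 'rV[R]_d.-1) (u e : R) :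
  (forall i, u0 0 (lift j i) <= v 0 i <= 1) ->
  u0 0 j <= u -> 0 < e -> u + e <= 1 ->
  fine (P [set w | (forall i, U (lift j i) w <= v 0 i) /\ u < U j w <= u + e])
       / fine (P [set w | u < U j w <= u + e]) =
  (generator_inv phi (\sum_(i < d.-1) phi (v 0 i) + phi (u + e)) -
   generator_inv phi (\sum_(i < d.-1) phi (v 0 i) + phi u)) / e.
Proof.
move=> hv hu e0 ue1.
have u0' : 0 < u by case/andP: (hu0 j) => h _; exact: lt_le_trans hu.
have hu1 : u0 0 j <= u <= 1 by rewrite hu/=; lra.
have hue : u0 0 j <= u + e <= 1 by rewrite ue1 andbT; lra.
have uue : u <= u + e by lra.
have h1 i : u0 0 (lift j i) <= (const_mx 1 : 'rV[R]_d.-1) 0 i <= 1.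
  by rewrite mxE lexx andbT ltW//; case/andP: (hu0 (lift j i)).
have S1 : \sum_(i < d.-1) phi ((const_mx 1 : 'rV[R]_d.-1) 0 i) = 0.
  by apply: big1 => i _; rewrite mxE (generator1 hphi).
have F1 : joint_cdf U (row_insert j 1 (const_mx 1)) = 1.
  rewrite joint_cdf_row_insert// ?lexx ?andbT; last first.
    by rewrite ltW//; case/andP: (hu0 j).
  by rewrite S1 add0r (generatorK hphi)// ltr01 lexx.
rewrite (probability_slab_marginal _ _ F1) !probability_slab//.
rewrite !joint_cdf_row_insert//.
rewrite S1 !add0r !(generatorK hphi); [|lra|lra].
by congr (_ / _); lra.
Qed.
End joint.

(** * The limit theorem *)

Theorem theorem3p3 (R : realType) (d : nat) (hd : (2 <= d)%N)
  (phi : R -> R) (hphi : archimedean_generator phi)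
  (dT : measure_display) (T : measurableType dT) (P : probability T R)
  (U : 'I_d -> {RV P >-> R})
  (u0 : 'rV[R]_d) (hu0 : forall i, 0 < u0 0 i < 1)
  (hF : forall v : 'rV[R]_d, (forall i, u0 0 i <= v 0 i <= 1) ->
    joint_cdf U v = archimedean_cdf phi v)
  (p : R) (hp : 1 <= p)
  (hreg : forall x : R, 0 < x ->
    phi (1 - s * x) / phi (1 - s) @[s --> 0^'+] --> x `^ p)
  (j : 'I_d) (u : R) (hu : u0 0 j < u < 1)
  (hder : \forall v \near u,
    derivable phi v 1 /\ derivable (derive1 phi) v 1)
  (hcont : {for u, continuous (derive1n 2 phi)})
  (hphi2 : derive1n 2 phi u != 0) (hphi1 : derive1 phi u != 0)
  (x : 'rV[R]_d.-1) (hx : forall i, x 0 i <= 0) :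
  let c := (derive1 phi u ^+ 2 / derive1n 2 phi u) `^ p^-1 in
  let a := fun n : nat => 1 - generator_inv phi n%:R^-1 in
  cond_cdf U j u (const_mx 1 + (c * a n) *: x) ^+ n @[n --> \oo] -->
    expR (- \sum_(i < d.-1) (- x 0 i) `^ p).
Proof.
move=> c a.
have [uj u1] : u0 0 j < u /\ u < 1 by case/andP: hu.
have u01 : 0 < u < 1 by rewrite u1 andbT (lt_trans _ uj)//; case/andP: (hu0 j).
have p0 : 0 < p by exact: lt_le_trans hp.
have phi2_gt0 : 0 < derive1n 2 phi u.
  by rewrite lt_neqAle eq_sym hphi2; exact: second_derivative_ge0.
have b0 : 0 < derive1 phi u ^+ 2 / derive1n 2 phi u.
  by rewrite divr_gt0// exprn_even_gt0.
have c0 : 0 < c by exact: powR_gt0.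
have cp : c `^ p = derive1 phi u ^+ 2 / derive1n 2 phi u.
  by rewrite /c -powRrM mulVf ?gt_eqF// powRr1// ltW.
pose v n := const_mx 1 + (c * a n) *: x : 'rV[R]_d.-1.
have vE n i : v n 0 i = 1 + c * a n * x 0 i by rewrite !mxE.
pose s n := \sum_(i < d.-1) phi (v n 0 i).
have ns : n%:R * s n @[n --> \oo] -->
    \sum_(i < d.-1) c `^ p * (- x 0 i) `^ p.
  under eq_fun do rewrite mulr_sumr.
  apply: cvg_big => [|i _]; first exact: add_continuous.
  under eq_fun do rewrite vE.
  exact: generator_scaled_cvg.
have s0 := cvg0_scaled ns.
have a0 : a n @[n --> \oo] --> 0^'+ by exact: generator_inv_cvg1.
have v_upper : \forall n \near \oo, forall i, u0 0 (lift j i) <= v n 0 i <= 1.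
  apply: filter_forall => i; have /andP[_ ui1] := hu0 (lift j i).
  have v1 : v n 0 i @[n --> \oo] --> (1 : R).
    under eq_fun do rewrite vE.
    have limE : 1 + c * 0 * x 0 i = 1 by rewrite mulr0 mul0r addr0.
    suff : 1 + c * a n * x 0 i @[n --> \oo] --> 1 + c * 0 * x 0 i.
      by rewrite limE.
    apply: cvgD; first exact: cvg_cst.
    apply: cvgM; last exact: cvg_cst.
    apply: cvgM; first exact: cvg_cst.
    by apply: cvg_trans a0 _; exact: cvg_within.
  near=> n; apply/andP; split.
    by apply: ltW; near: n; exact: (cvgr_gt _ v1).
  have an : 0 < a n by near: n; exact: (a0 _ (nbhs_right_gt 0)).
  by rewrite vE gerDl mulr_ge0_le0// mulr_ge0// ltW.
(* [c] cancels the slope of [H] at [0], the rate of the limit of [H (s n)^n]. *)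
have -> : - \sum_(i < d.-1) (- x 0 i) `^ p =
    - (derive1n 2 phi u / derive1 phi u ^+ 2) *
    \sum_(i < d.-1) c `^ p * (- x 0 i) `^ p.
  rewrite -mulr_sumr cp mulrA mulNr mulrA divfK ?sqrf_eq0//.
  by rewrite divff// mulN1r.
have dH := cond_ratio_is_derive hphi u01 hder hphi1.
apply: cvg_trans (expn_cvg_expR _ dH ns); last first.
  by rewrite addr0 (generatorK hphi) ?divff//; case/andP: u01 => -> /ltW ->.
apply: near_eq_cvg; near=> n; congr (_ ^+ n).
have vn i : u0 0 (lift j i) <= v n 0 i <= 1 by move: i; near: n.
rewrite /cond_cdf; apply/esym/cvg_lim => //.
have : (generator_inv phi (s n + phi (u + e)) -
    generator_inv phi (s n + phi u)) / e @[e --> 0^'+] -->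
    derive1 phi u / derive1 phi (generator_inv phi (phi u + s n)).
  near: n; exact: (s0 _ (cond_ratio_cvg hphi u01 hder hphi1)).
apply: cvg_trans; apply: near_eq_cvg; near=> e.
rewrite (cond_ratioE hphi hu0 hF)//.
- exact: ltW.
- by rewrite -lerBrDl; near: e; apply: nbhs_right_le; rewrite subr_gt0.
Unshelve. all: by end_near. Qed.
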